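(* Let $J$ be a finite index set, let $(v_j)_{j\in J}$ be vectors in $\mathbf{R}^p$, and let $F$ be the matrix with columns $(v_j)_{j\in J}$. Suppose that $S\ge 1$ is an integer such that $$\delta_S+\theta_{S,S}+\theta_{S,2S}<1,$$ and let $c\in\mathbf{R}^J$ be a real vector supported on a set $T\subset J$ with $|T|\le S$. Put $f:=Fc$. Then $c$ is the unique minimizer of the problem $$\min_{d\in\mathbf{R}^J}\ \|d\|_{\ell_1}\qquad\text{subject to}\qquad Fd=f .$$
   Context: Notation: $\|\cdot\|$ is the Euclidean norm, $\langle\cdot,\cdot\rangle$ the Euclidean inner product, and $\|d\|_{\ell_1}=\sum_j|d_j|$. For $T\subseteq J$, $F_T$ is the submatrix of $F$ with columns $v_j$, $j\in T$, so $F_Tc=\sum_{j\in T}c_jv_j$ for $c\in\mathbf{R}^T$. Restricted isometry constants: for an integer $1\le S\le|J|$, $\delta_S$ is the smallest quantity such that $(1-\delta_S)\|c\|^2\le\|F_Tc\|^2\le(1+\delta_S)\|c\|^2$ for all $T\subset J$ with $|T|\le S$ and all real $(c_j)_{j\in T}$. Restricted orthogonality constants: for integers $S,S'\geq 1$ with $S+S'\le|J|$, $\theta_{S,S'}$ is the smallest quantity such that $|\langle F_Tc,F_{T'}c'\rangle|\le\theta_{S,S'}\|c\|\,\|c'\|$ for all disjoint $T,T'\subseteq J$ with $|T|\le S$, $|T'|\le S'$ and all real coefficient vectors $c\in\mathbf{R}^T$, $c'\in\mathbf{R}^{T'}$. The use of $\theta_{S,2S}$ presupposes $3S\le|J|$.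 *)

(* Defs.v *)
From mathcomp Require Import all_boot all_order all_algebra.
From mathcomp Require Import all_classical all_reals.

Set Implicit Arguments.
Unset Strict Implicit.
Unset Printing Implicit Defensive.

Import Order.TTheory GRing.Theory Num.Theory.

Local Open Scope classical_set_scope.
Local Open Scope ring_scope.

Section Defs.
Variables (R : realType) (J : finType) (p : nat).
Implicit Types (u w : 'cV[R]_p) (v : J -> 'cV[R]_p) (T : {set J}).
Implicit Types (c d : {ffun J -> R}) (S : nat).

Definition inner u w : R := \sum_(i < p) u i 0 * w i 0.

(* The norm of mathcomp-analysis on matrices is the sup norm, hence this
   explicit Euclidean norm. *)
Definition enorm u : R := Num.sqrt (inner u u).

Definition l1norm d : R := \sum_j `|d j|.

(* An element of R^T is represented by any c in R^J extending it: only the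
   values of c on T enter cnorm T c and submul v T c. *)
Definition cnorm T c : R := Num.sqrt (\sum_(j in T) c j ^+ 2).

(* F_T c, where the v j are the columns of F *)
Definition submul v T c : 'cV[R]_p := \sum_(j in T) c j *: v j.

(* F c *)
Definition fullmul v c : 'cV[R]_p := \sum_j c j *: v j.

Definition restricted_isometry v S (delta : R) : Prop :=
  forall T c, (#|T| <= S)%N ->
    (1 - delta) * cnorm T c ^+ 2 <= enorm (submul v T c) ^+ 2
      <= (1 + delta) * cnorm T c ^+ 2.

(* The infimum is attained when 1 <= S and J is nonempty; see ricP. *)
Definition ric v S : R := inf [set delta | restricted_isometry v S delta].

Definition restricted_orthogonality v S S' (theta : R) : Prop :=
  forall T T' c c', [disjoint T & T']%B -> (#|T| <= S)%N -> (#|T'| <= S')%N ->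
    `|inner (submul v T c) (submul v T' c')| <= theta * cnorm T c * cnorm T' c'.

(* The infimum is attained when 1 <= S, 1 <= S' and S + S' <= #|J|;
   see rocP. *)
Definition roc v S S' : R :=
  inf [set theta | restricted_orthogonality v S S' theta].

End Defs.

Definition minimizer (R : realType) (X : Type) (A : set X) (g : X -> R)
    (x : X) : Prop :=
  A x /\ forall y, A y -> g x <= g y.

Definition unique_minimizer (R : realType) (X : Type) (A : set X) (g : X -> R)
    (x : X) : Prop :=
  minimizer A g x /\ forall y, minimizer A g y -> y = x.

Section SmallestConstants.
Variables (R : realType) (J : finType) (p : nat) (v : J -> 'cV[R]_p).
Implicit Types (T : {set J}) (c : {ffun J -> R}).

Let le_inf_mul (E : set R) (a b : R) :
  E !=set0 -> 0 <= b -> (forall x, E x -> a <= x * b) -> a <= inf E * b.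
Proof.
move=> E0; rewrite le_eqVlt => /predU1P[<- H|b0 H].
  by have [x /H] := E0; rewrite !mulr0.
rewrite -ler_pdivrMr//; apply: lb_le_inf => // x /H.
by rewrite ler_pdivrMr.
Qed.

Let cnorm_ge0 T c : 0 <= cnorm T c. Proof. exact: sqrtr_ge0. Qed.

Let sqr_enorm (u : 'cV[R]_p) : enorm u ^+ 2 = inner u u.
Proof.
by rewrite sqr_sqrtr//; apply: sumr_ge0 => i _; rewrite -expr2 sqr_ge0.
Qed.

Let cnorm_coord T c j : j \in T -> `|c j| <= cnorm T c.
Proof.
move=> jT; rewrite -sqrtr_sqr ler_wsqrtr// (bigD1 j)//= lerDl.
by apply: sumr_ge0 => i _; rewrite sqr_ge0.
Qed.

Let submul_coord T c i :
  `|submul v T c i 0| <= cnorm T c * \sum_j `|v j i 0|.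
Proof.
rewrite summxE (le_trans (ler_norm_sum _ _ _))// mulr_sumr.
rewrite big_mkcond ler_sum// => j _; case: ifP => jT.
  by rewrite mxE normrM ler_wpM2r// cnorm_coord.
by rewrite mulr_ge0.
Qed.

Let K : R := \sum_(i < p) (\sum_j `|v j i 0|) ^+ 2.

Let K_ge0 : 0 <= K.
Proof. by apply: sumr_ge0 => i _; rewrite sqr_ge0. Qed.

Let inner_submul T T' c c' :
  `|inner (submul v T c) (submul v T' c')| <= K * cnorm T c * cnorm T' c'.
Proof.
rewrite (le_trans (ler_norm_sum _ _ _))// -mulrA mulr_suml ler_sum// => i _.
rewrite normrM (le_trans (ler_pM _ _ (submul_coord _ _ _)
  (submul_coord _ _ _)))//.
by rewrite mulrACA -expr2 mulrC.
Qed.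

Let cnorm1 (j : J) : cnorm [set j]%SET [ffun=> 1 : R] = 1.
Proof. by rewrite /cnorm big_set1 ffunE expr1n sqrtr1. Qed.

Lemma ricP S : (1 <= S)%N -> (1 <= #|J|)%N ->
  restricted_isometry v S (ric v S) /\
  forall delta, restricted_isometry v S delta -> ric v S <= delta.
Proof.
move=> S0 /card_gt0P[j _].
set E := [set delta | restricted_isometry v S delta].
have E0 : E !=set0.
  exists (1 + K) => T c _; apply/andP; split.
    rewrite opprD addrA subrr add0r mulNr.
    by rewrite (@le_trans _ _ 0) ?sqr_ge0// oppr_le0 mulr_ge0// sqr_ge0.
  rewrite sqr_enorm; apply: le_trans (ler_norm _) _.
  apply: le_trans (inner_submul _ _ _ _) _.
  by rewrite -mulrA -expr2 ler_wpM2r ?sqr_ge0// addrA lerDr addr_ge0.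
have lE : has_lbound E.
  exists 0 => delta /(_ [set j]%SET [ffun=> 1]).
  rewrite cards1 cnorm1 expr1n !mulr1 => /(_ S0) /andP[h1 h2].
  have := le_trans h1 h2; rewrite lerD2l -subr_ge0 opprK -mulr2n.
  by rewrite pmulrn_lge0.
split; last by move=> delta ?; apply: ge_inf.
move=> T c TS; apply/andP; split.
  rewrite mulrBl mul1r lerBlDr -lerBlDl; apply: le_inf_mul => //.
    by rewrite sqr_ge0.
  move=> x /(_ T c TS)/andP[+ _].
  by rewrite mulrBl mul1r lerBlDr -lerBlDl.
rewrite mulrDl mul1r -lerBlDl; apply: le_inf_mul => //.
  by rewrite sqr_ge0.
move=> x /(_ T c TS)/andP[_].
by rewrite mulrDl mul1r -lerBlDl.
Qed.

Lemma rocP S S' : (1 <= S)%N -> (1 <= S')%N -> (S + S' <= #|J|)%N ->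
  restricted_orthogonality v S S' (roc v S S') /\
  forall theta, restricted_orthogonality v S S' theta -> roc v S S' <= theta.
Proof.
move=> S0 S'0 SJ.
have /card_gt1P[j [k [_ _ jk]]] : (1 < #|J|)%N.
  by rewrite (leq_trans _ SJ)// (leq_add S0 S'0).
set E := [set theta | restricted_orthogonality v S S' theta].
have E0 : E !=set0 by exists K => T T' c c' _ _ _; exact: inner_submul.
have lE : has_lbound E.
  exists 0 => theta /(_ [set j]%SET [set k]%SET [ffun=> 1] [ffun=> 1]).
  rewrite !cards1 !cnorm1 !mulr1 disjoints1 inE jk => /(_ isT S0 S'0).
  exact: le_trans.
split; last by move=> theta ?; apply: ge_inf.
move=> T T' c c' TT' TS TS'; rewrite -mulrA; apply: le_inf_mul => //.
  by rewrite mulr_ge0.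
by move=> x /(_ T T' c c' TT' TS TS'); rewrite -mulrA.
Qed.

End SmallestConstants.

(* Main.v *)
Require Import Defs.
From mathcomp Require Import all_boot all_order all_algebra.
From mathcomp Require Import all_classical all_reals.
From mathcomp Require Import ring lra.

Import Order.TTheory GRing.Theory Num.Theory.
Local Open Scope classical_set_scope.
Local Open Scope ring_scope.

(** Let [h = d - c], where [d] is feasible and has l1 norm at most that of [c].
Then [F h = 0], and, [c] living on [T], the l1 mass of [h] off [T] is at most
its mass on [T] ([l1_cone]).

Replace [T] by the set [T0] of the [S] largest entries of [h] in absolute value
([exists_largest]): it still carries at least half of the l1 mass ([l1_largest],
[largest_half_mass]).  Cut the complement of [T0] into blocks [T1], [T2], ... of
size [S], in decreasing order of absolute value.  The absolute values in a block
are at most the mean of those in the previous one, so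
[|h_T(i+1)| <= |h_Ti|_1 / sqrt S].  Hence the Euclidean norms of [T2], [T3], ...
add up to at most [|h_T0^c|_1 / sqrt S <= |h_T0|_1 / sqrt S <= |h_T0|], and
[|h_T1| <= |h_T0|] by the choice of [T0].  Restricted orthogonality of [T0] with
each block ([inner_tail_le]) and [F h_T0 = - F h_T0^c] give
[(1 - delta_S) |h_T0|^2 <= |F h_T0|^2 <= 2 theta_{S,S} |h_T0|^2].
Since [theta_{S,S} <= theta_{S,2S}] ([roc_le]), the hypothesis makes
[2 theta_{S,S} < 1 - delta_S], so [h_T0 = 0]; as [T0] holds the largest entries,
[h = 0].  Thus every feasible [d <> c] has a larger l1 norm than [c]. *)

(** * Euclidean and l1 norms of restrictions *)

Section Norms.
Variables (R : realType) (J : finType).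
Implicit Types (V : {set J}) (h : {ffun J -> R}).

Lemma cnorm_ge0 V h : 0 <= cnorm V h.
Proof. exact: sqrtr_ge0. Qed.

Lemma sqr_cnorm V h : cnorm V h ^+ 2 = \sum_(j in V) h j ^+ 2.
Proof. by rewrite sqr_sqrtr// sumr_ge0// => j _; rewrite sqr_ge0. Qed.

Lemma cnorm_le_sup V h (S : nat) (M : R) : (#|V| <= S)%N -> 0 <= M ->
  (forall j, j \in V -> `|h j| <= M) -> cnorm V h <= Num.sqrt S%:R * M.
Proof.
move=> VS M0 hM.
rewrite -(@ler_pXn2r _ 2%N) ?nnegrE ?cnorm_ge0 ?mulr_ge0 ?sqrtr_ge0//.
rewrite sqr_cnorm exprMn sqr_sqrtr ?ler0n//.
apply: (@le_trans _ _ (\sum_(j in V) M ^+ 2)).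
  apply: ler_sum => j /hM hjM.
  by rewrite -(real_normK (num_real (h j))) lerXn2r ?nnegrE.
by rewrite sumr_const -[_ *+ _]mulr_natl ler_wpM2r ?sqr_ge0// ler_nat.
Qed.

(** Cauchy-Schwarz against the constant vector, from
[2 a b <= a ^+ 2 + b ^+ 2] summed over all pairs of indices. *)
Lemma l1_le_cnorm V h (S : nat) : (#|V| <= S)%N ->
  \sum_(j in V) `|h j| <= Num.sqrt S%:R * cnorm V h.
Proof.
move=> VS.
rewrite -(@ler_pXn2r _ 2%N) ?nnegrE ?sumr_ge0 ?mulr_ge0 ?sqrtr_ge0//.
rewrite exprMn sqr_sqrtr ?ler0n//.
apply: (@le_trans _ _ (#|V|%:R * cnorm V h ^+ 2)); last first.
  by rewrite ler_wpM2r ?sqr_ge0// ler_nat.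
rewrite sqr_cnorm expr2 mulr_suml.
apply: (@le_trans _ _
  (\sum_(i in V) \sum_(j in V) (h i ^+ 2 / 2 + h j ^+ 2 / 2))).
  apply: ler_sum => i _; rewrite mulr_sumr; apply: ler_sum => j _.
  have := sqr_ge0 (`|h i| - `|h j|).
  by rewrite sqrrB !real_normK ?num_real//; lra.
under eq_bigr => i _ do rewrite big_split /= sumr_const.
rewrite big_split /= sumr_const sumrMnl -mulr_suml -mulrnDl -splitr.
by rewrite mulr_natl.
Qed.

End Norms.

(** * The largest entries of a vector *)

Section Largest.
Local Open Scope set_scope.
Variables (R : realType) (J : finType).
Implicit Types (A V T : {set J}) (x : J -> R).

(** The threshold [m] separates the chosen entries from the others; keeping it
explicit makes [k = 0] and [k = #|A|] ordinary cases. *)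
Lemma exists_largest A x (k : nat) : (forall j, 0 <= x j) -> (k <= #|A|)%N ->
  exists V, exists m : R, [/\ V \subset A, #|V| = k, 0 <= m,
    forall j, j \in V -> m <= x j & forall j, j \in A :\: V -> x j <= m].
Proof.
move=> x0; elim: k => [_|k IH kA].
  (* Any nonnegative upper bound of [x] serves as the threshold here. *)
  exists finset.set0, (\sum_j x j).
  split; rewrite ?finset.sub0set ?cards0 ?sumr_ge0//.
    by move=> j; rewrite finset.inE.
  by move=> j _; rewrite (bigD1 j)//= lerDl sumr_ge0.
have [V [m [VA Vk m0 mV Vm]]] := IH (ltnW kA).
have /card_gt0P[i0 i0AV] : (0 < #|A :\: V|)%N.
  by rewrite cardsD (finset.setIidPr VA) Vk subn_gt0.
case: (Order.TotalTheory.arg_maxP x i0AV) => i iAV imax.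
have /setDP[iA iV] := iAV.
exists (i |: V), (x i); split => //.
- by rewrite finset.subUset finset.sub1set iA.
- by rewrite cardsU1 iV Vk.
- move=> j /setU1P[->//|/mV]; apply: le_trans; exact: Vm.
- move=> j; rewrite !finset.inE negb_or => /andP[/andP[_ jV] jA].
  by apply: imax; apply/setDP.
Qed.

(** Off the common part, [V] has at least as many elements as [T], all above
the threshold, whereas those of [T] are below it; as [m] is nonnegative, the
surplus elements of [V] can only help. *)
Lemma l1_largest T V x (m : R) : 0 <= m -> (#|T| <= #|V|)%N ->
  (forall j, j \in V -> m <= x j) -> (forall j, j \notin V -> x j <= m) ->
  \sum_(j in T) x j <= \sum_(j in V) x j.
Proof.
move=> m0 TV mV Vm.
rewrite (big_setID V) [leRHS](big_setID T) /= finset.setIC lerD2l.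
apply: (@le_trans _ _ (\sum_(j in T :\: V) m)).
  by apply: ler_sum => j; rewrite finset.inE => /andP[/Vm].
apply: (@le_trans _ _ (\sum_(j in V :\: T) m)); last first.
  by apply: ler_sum => j; rewrite finset.inE => /andP[_ /mV].
rewrite !sumr_const ler_wpMn2l//.
by rewrite !cardsD finset.setIC leq_sub2r.
Qed.

Lemma sum_setC T x : \sum_j x j = \sum_(j in T) x j + \sum_(j in ~: T) x j.
Proof.
rewrite (bigID (mem T)) /=; congr (_ + _); apply: eq_bigl => j.
by rewrite finset.inE.
Qed.

(** The total mass being fixed, what [V] gains over [T] its complement loses. *)
Lemma largest_half_mass T V x (m : R) : 0 <= m -> (#|T| <= #|V|)%N ->
  (forall j, j \in V -> m <= x j) -> (forall j, j \notin V -> x j <= m) ->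
  \sum_(j in ~: T) x j <= \sum_(j in T) x j ->
  \sum_(j in ~: V) x j <= \sum_(j in V) x j.
Proof.
move=> m0 TV mV Vm.
have := sum_setC T x; rewrite (sum_setC V x).
by have := l1_largest _ _ _ _ m0 TV mV Vm; lra.
Qed.

End Largest.

(** * Inner products with a tail *)

Section Tail.
Local Open Scope set_scope.
Variables (R : realType) (J : finType) (p : nat) (v : J -> 'cV[R]_p).
Implicit Types (T U V : {set J}) (h : {ffun J -> R}).

Lemma innerDr (u w z : 'cV[R]_p) : inner u (w + z) = inner u w + inner u z.
Proof.
by rewrite /inner -big_split; apply: eq_bigr => i _; rewrite mxE mulrDr.
Qed.

Lemma innerNr (u w : 'cV[R]_p) : inner u (- w) = - inner u w.
Proof.
by rewrite /inner -sumrN; apply: eq_bigr => i _; rewrite mxE mulrN.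
Qed.

Lemma sqr_enorm (u : 'cV[R]_p) : enorm u ^+ 2 = inner u u.
Proof.
by rewrite sqr_sqrtr// sumr_ge0// => i _; rewrite -expr2 sqr_ge0.
Qed.

(** Tested on two distinct singletons: the bound would be vacuous, and [theta]
arbitrary, if no two nonempty disjoint sets existed. *)
Lemma restricted_orthogonality_ge0 S S' (theta : R) :
  (1 <= S)%N -> (1 <= S')%N -> (1 < #|J|)%N ->
  restricted_orthogonality v S S' theta -> 0 <= theta.
Proof.
move=> S0 S'0 /card_gt1P[j [k [_ _ jk]]].
have e1 i : cnorm [set i]%SET [ffun=> 1 : R] = 1.
  by rewrite /cnorm big_set1 ffunE expr1n sqrtr1.
move=> /(_ [set j]%SET [set k]%SET [ffun=> 1] [ffun=> 1]).
rewrite !cards1 !e1 !mulr1 disjoints1 finset.inE jk => /(_ isT S0 S'0).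
exact: le_trans.
Qed.

Lemma roc_le S S1 S2 : (1 <= S)%N -> (1 <= S1)%N -> (S1 <= S2)%N ->
  (S + S2 <= #|J|)%N -> roc v S S1 <= roc v S S2.
Proof.
move=> S0 S10 S12 SJ.
have S1J : (S + S1 <= #|J|)%N by rewrite (leq_trans _ SJ)// leq_add2l.
have [_] := rocP v S0 S10 S1J; apply.
have [H _] := rocP v S0 (leq_trans S10 S12) SJ.
by move=> T T' c c' TT' TS TS1; apply: H => //; apply: leq_trans S12.
Qed.

(** Peel off the [S] largest entries of [U]: they cost [sqrt S * M], and the
threshold [m] below which the rest lies satisfies [S * m <= |h_V|_1], so the
first term [sqrt S * m] of the bound for the rest is paid by the l1 mass of the
peeled block. *)
Lemma inner_tail_le S (theta M : R) T U h : (1 <= S)%N -> 0 <= theta ->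
  restricted_orthogonality v S S theta -> (#|T| <= S)%N -> [disjoint T & U]%B ->
  0 <= M -> (forall j, j \in U -> `|h j| <= M) ->
  `|inner (submul v T h) (submul v U h)| <= theta * cnorm T h *
     (Num.sqrt S%:R * M + (\sum_(j in U) `|h j|) / Num.sqrt S%:R).
Proof.
move=> S0 th0 RO TS.
have s0 : 0 < Num.sqrt (S%:R : R) by rewrite sqrtr_gt0 ltr0n.
have tT : 0 <= theta * cnorm T h by rewrite mulr_ge0 ?cnorm_ge0.
have block V M' : [disjoint T & V]%B -> (#|V| <= S)%N -> 0 <= M' ->
    (forall j, j \in V -> `|h j| <= M') ->
    `|inner (submul v T h) (submul v V h)|
      <= theta * cnorm T h * (Num.sqrt S%:R * M').
  move=> TV VS M0 hM; apply: le_trans (RO _ _ h h TV TS VS) _.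
  by rewrite ler_wpM2l// cnorm_le_sup.
have [n] := ubnP #|U|; elim: n U M => // n IH U M Un TU M0 hM.
have [US|SU] := leqP #|U| S.
  apply: le_trans (block U M TU US M0 hM) _.
  by rewrite ler_wpM2l// lerDl divr_ge0 ?sumr_ge0// ltW.
have [V [m [VU VS m0 mV Vm]]] :=
  exists_largest _ _ U (fun j => `|h j|) S (fun j => normr_ge0 _) (ltnW SU).
have TV : [disjoint T & V]%B by apply: disjointWr TU.
have UV : (#|U :\: V| < n)%N.
  rewrite cardsD (finset.setIidPr VU) VS -ltnS (leq_trans _ Un)// ltnS.
  by rewrite ltn_subrL S0 (leq_trans _ SU).
have TUV : [disjoint T & U :\: V]%B.
  by apply: disjointWr TU; exact: finset.subsetDl.
have bV : `|inner (submul v T h) (submul v V h)|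
    <= theta * cnorm T h * (Num.sqrt S%:R * M).
  apply: block => //; first by rewrite VS.
  by move=> j jV; apply: hM; exact: (fintype.subsetP VU).
have bUV := IH _ _ UV TUV m0 Vm.
have -> : submul v U h = submul v V h + submul v (U :\: V) h.
  by rewrite /submul (big_setID V) /= (finset.setIidPr VU).
rewrite (big_setID V) /= (finset.setIidPr VU) innerDr.
have mass : Num.sqrt S%:R * m <= (\sum_(j in V) `|h j|) / Num.sqrt S%:R.
  rewrite ler_pdivlMr// mulrAC -expr2 sqr_sqrtr ?ler0n//.
  apply: (@le_trans _ _ (\sum_(j in V) m)); last exact: ler_sum.
  by rewrite sumr_const VS mulr_natl.
apply: le_trans (ler_normD _ _) _; apply: le_trans (lerD bV bUV) _.
rewrite -mulrDr ler_wpM2l// mulrDl lerD2l lerD2r.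
exact: mass.
Qed.

End Tail.

(** * Recovery *)

Section Recovery.
Local Open Scope set_scope.
Variables (R : realType) (J : finType) (p : nat) (v : J -> 'cV[R]_p).
Implicit Types (c d h : {ffun J -> R}) (T : {set J}).

(** Changing [c] by [h = d - c] lowers the l1 norm on [T] by at most the mass
of [h] there, and raises it off [T], where [c] vanishes, by exactly the mass of
[h] there. *)
Lemma l1_cone c d T : (forall j, j \notin T -> c j = 0) ->
  l1norm d <= l1norm c ->
  \sum_(j in ~: T) `|d j - c j| <= \sum_(j in T) `|d j - c j|.
Proof.
move=> cT; rewrite /l1norm !(sum_setC _ _ T).
have -> : \sum_(j in ~: T) `|c j| = 0.
  by apply: big1 => j; rewrite finset.inE => /cT ->; rewrite normr0.
have -> : \sum_(j in ~: T) `|d j - c j| = \sum_(j in ~: T) `|d j|.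
  by apply: eq_bigr => j; rewrite finset.inE => /cT ->; rewrite subr0.
have : \sum_(j in T) `|c j|
    <= \sum_(j in T) `|d j| + \sum_(j in T) `|d j - c j|.
  rewrite -big_split; apply: ler_sum => j _ /=.
  by rewrite -lerBlDl distrC lerB_dist.
by lra.
Qed.

(** The null space property of order [S].  Taking the [S] largest entries [V]
instead of [T] lets [|h_V|] bound both terms of the estimate of the tail: the
threshold because all entries of [V] exceed it, and the l1 mass off [V] by
Cauchy-Schwarz on [V]. *)
Lemma null_space_eq0 S (delta theta : R) h T : (1 <= S)%N -> (S <= #|J|)%N ->
  0 <= theta -> delta + 2 * theta < 1 -> restricted_isometry v S delta ->
  restricted_orthogonality v S S theta -> (#|T| <= S)%N ->
  fullmul v h = 0 -> \sum_(j in ~: T) `|h j| <= \sum_(j in T) `|h j| ->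
  h = [ffun=> 0].
Proof.
move=> S0 SJ th0 dth RI RO TS Fh cone.
have s0 : 0 < Num.sqrt (S%:R : R) by rewrite sqrtr_gt0 ltr0n.
have SA : (S <= #|[set: J]|)%N by rewrite cardsT.
have [V [m [_ VS m0 mV Vm']]] :=
  exists_largest _ _ _ (fun j => `|h j|) S (fun j => normr_ge0 _) SA.
have Vm j : j \notin V -> `|h j| <= m.
  by move=> jV; apply: Vm'; rewrite !finset.inE jV.
have half : \sum_(j in ~: V) `|h j| <= \sum_(j in V) `|h j|.
  by apply: largest_half_mass m0 _ mV Vm cone; rewrite VS.
have l1V : \sum_(j in V) `|h j| <= Num.sqrt S%:R * cnorm V h.
  by apply: l1_le_cnorm; rewrite VS.
have sm : Num.sqrt S%:R * m <= cnorm V h.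
  rewrite -(ler_pM2l s0) mulrA -expr2 sqr_sqrtr ?ler0n//.
  apply: le_trans l1V; apply: (@le_trans _ _ (\sum_(j in V) m)).
    by rewrite sumr_const VS mulr_natl.
  exact: ler_sum.
have FV : submul v V h = - submul v (~: V) h.
  apply/eqP; rewrite -addr_eq0 -Fh /fullmul (bigID (mem V)) /=; apply/eqP.
  by congr (_ + _); apply: eq_bigl => j; rewrite finset.inE.
have VVC : [disjoint V & ~: V]%B by rewrite -setI_eq0 finset.setICr.
have VCm j : j \in ~: V -> `|h j| <= m by rewrite finset.inE => /Vm.
have VleS : (#|V| <= S)%N by rewrite VS.
have tail := inner_tail_le _ _ _ v S theta m V _ h S0 th0 RO VleS VVC m0 VCm.
have upper : enorm (submul v V h) ^+ 2 <= 2 * theta * cnorm V h ^+ 2.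
  rewrite sqr_enorm {2}FV innerNr.
  apply: le_trans (ler_norm _) _; rewrite normrN; apply: le_trans tail _.
  have -> : 2 * theta * cnorm V h ^+ 2
      = theta * cnorm V h * (cnorm V h + cnorm V h) by ring.
  rewrite ler_wpM2l ?mulr_ge0 ?cnorm_ge0// lerD//.
  by rewrite ler_pdivrMr// [leRHS]mulrC (le_trans half).
have /andP[lower _] := RI V h VleS.
have V0 : cnorm V h ^+ 2 = 0.
  apply/eqP; rewrite eq_le sqr_ge0 andbT -subr_ge0 add0r.
  rewrite -(@pmulr_rge0 _ (1 - delta - 2 * theta)); last by lra.
  by rewrite mulrN oppr_ge0 mulrBl subr_le0 (le_trans lower).
(* The threshold vanishes with the entries of [V], since [V] is nonempty. *)
have m_eq0 : m = 0.
  apply/eqP; rewrite eq_le m0 andbT -(ler_pM2l s0) mulr0 (le_trans sm)//.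
  by move/eqP: V0; rewrite sqrf_eq0 => /eqP ->.
apply/ffunP => j; rewrite ffunE; apply/eqP.
have [jV|/Vm] := boolP (j \in V); last by rewrite m_eq0 normr_le0.
move: V0; rewrite sqr_cnorm => /psumr_eq0P.
by move=> /(_ (fun i _ => sqr_ge0 _) j jV)/eqP; rewrite sqrf_eq0.
Qed.

Lemma fullmulB c d : fullmul v [ffun j => d j - c j] = fullmul v d - fullmul v c.
Proof.
by rewrite /fullmul -sumrB; apply: eq_bigr => j _; rewrite ffunE scalerBl.
Qed.

End Recovery.

Theorem theorem1p4 (R : realType) (J : finType) (p : nat)
    (v : J -> 'cV[R]_p) (S : nat) (S_ge1 : (1 <= S)%N)
    (S_le : (3 * S <= #|J|)%N)
    (hS : ric v S + roc v S S + roc v S (2 * S) < 1)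
    (c : {ffun J -> R}) (T : {set J})
    (cT : forall j, j \notin T -> c j = 0) (TS : (#|T| <= S)%N)
    (f : 'cV[R]_p) (hf : f = fullmul v c) :
  unique_minimizer [set d : {ffun J -> R} | fullmul v d = f]
    (fun d => l1norm d) c.
Proof.
have S3J : (S + 2 * S <= #|J|)%N by rewrite -mulSn.
have S2J : (S + S <= #|J|)%N.
  by rewrite (leq_trans _ S3J)// leq_add2l leq_pmull.
have SJ : (S <= #|J|)%N by rewrite (leq_trans _ S2J)// leq_addr.
have J1 : (1 < #|J|)%N by rewrite (leq_trans _ S2J)// (leq_add S_ge1 S_ge1).
have [RI _] := ricP v S_ge1 (leq_trans S_ge1 SJ).
have [RO _] := rocP v S_ge1 S_ge1 S2J.
have th0 := restricted_orthogonality_ge0 _ _ _ v _ _ _ S_ge1 S_ge1 J1 RO.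
have th12 : roc v S S <= roc v S (2 * S) by apply: roc_le; rewrite ?leq_pmull.
have key d : fullmul v d = f -> l1norm d <= l1norm c -> d = c.
  move=> dF dc.
  have h0 : [ffun j => d j - c j] = [ffun=> 0 : R].
    apply: (null_space_eq0 _ _ _ v S _ _ _ T S_ge1 SJ th0 _ RI RO TS).
    - by lra.
    - by rewrite fullmulB dF hf subrr.
    - under eq_bigr do rewrite ffunE.
      under [leRHS]eq_bigr do rewrite ffunE.
      exact: l1_cone.
  apply/ffunP => j; apply/eqP; rewrite -subr_eq0.
  by have /ffunP/(_ j) := h0; rewrite !ffunE => ->.
split; first split => //= d dF.
  by case/orP: (le_total (l1norm c) (l1norm d)) => // /(key d dF) ->.
by move=> d [dF /(_ c (esym hf))]; exact: key.
Qed.
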